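(* Let $a\geq 4$ and let $k$ be an integer with $2\leq k\leq a/2$. Let $D$ be a strongly connected balanced bipartite digraph of order $2a$ satisfying condition $B_k$. Then $D$ contains a cycle factor.
   Context: Digraphs are finite, without loops and without multiple arcs (2-cycles $x\to y\to x$ are allowed). A digraph is bipartite with partite sets $X,Y$ if every arc has one end in $X$ and the other in $Y$; it is balanced if $|X|=|Y|$. For a vertex $x$, $d(x)=d^+(x)+d^-(x)$ is the sum of its out-degree and in-degree. A pair of distinct vertices $\{x,y\}$ is called dominating if there is a vertex $z$ with $xz\in A(D)$ and $yz\in A(D)$ (a common out-neighbour). A balanced bipartite digraph of order $2a$ satisfies condition $B_k$ if for every dominating pair $\{x,y\}$ we have either ($d(x)\geq 2a-k$ and $d(y)\geq a+k$) or ($d(x)\geq a+k$ and $d(y)\geq 2a-k$). A cycle factor of $D$ is a collection of vertex-disjoint directed cycles whose vertex sets together cover $V(D)$. *)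

(* Defs.v *)
From mathcomp Require Import all_boot.

Set Implicit Arguments.
Unset Strict Implicit.
Unset Printing Implicit Defensive.

(* A digraph is a finType T of vertices with an irreflexive arc relation
   e : rel T; irreflexivity is a hypothesis wherever it is required. *)

Definition outdeg (T : finType) (e : rel T) (x : T) : nat := #|[set y | e x y]|.

Definition indeg (T : finType) (e : rel T) (x : T) : nat := #|[set y | e y x]|.

Definition deg (T : finType) (e : rel T) (x : T) : nat :=
  outdeg e x + indeg e x.

Definition bipartite (T : finType) (e : rel T) (X Y : {set T}) : Prop :=
  [/\ X :|: Y = [set: T],
      X :&: Y = set0 &
      forall x y, e x y ->
        (x \in X /\ y \in Y) \/ (x \in Y /\ y \in X)].

Definition strongly_connected (T : finType) (e : rel T) : Prop :=
  forall x y, connect e x y.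

Definition dominating_pair (T : finType) (e : rel T) (x y : T) : Prop :=
  x <> y /\ exists z, e x z /\ e y z.

(* The subtraction is truncated, which is harmless when k <= 2 * a. *)
Definition condB (T : finType) (e : rel T) (a k : nat) : Prop :=
  forall x y, dominating_pair e x y ->
    (2 * a - k <= deg e x /\ a + k <= deg e y) \/
    (a + k <= deg e x /\ 2 * a - k <= deg e y).

(* The vertices of c are listed in cyclic order; 2-cycles are allowed. *)
Definition dicycle (T : finType) (e : rel T) (c : seq T) : Prop :=
  [/\ 1 < size c, uniq c & cycle e c].

Definition cycle_factor (T : finType) (e : rel T) (F : seq (seq T)) : Prop :=
  [/\ forall c, c \in F -> dicycle e c,
      pairwise (fun c1 c2 : seq T => [disjoint c1 & c2]) F &
      forall x : T, exists2 c, c \in F & x \in c].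

(* Main.v *)
(** By Hall's theorem an injective choice of out-neighbours exists unless some
    set S, which may be taken inside one partite set, has fewer out-neighbours
    than elements; its orbits form a cycle factor.  Take such an S of minimal
    size.  Two of its vertices form a dominating pair, so condition B_k forces
    |N(S)| >= a - k.  Hence each vertex of the set R of vertices on the other
    side outside N(S) has degree below a + k and lies in no dominating pair.
    The out-neighbours W of R thus have in-degree 1, hence degree at most
    a + 1 < a + k, and lie in no dominating pair either.  Since |W| >= |R|, W
    meets S, and removing W from S removes at least as many out-neighbours as
    vertices, contradicting minimality. *)

Require Import Defs.
From mathcomp Require Import all_boot zify.

Set Implicit Arguments.
Unset Strict Implicit.
Unset Printing Implicit Defensive.

(** * Hall's marriage theorem *)

Definition outnbrs (T U : finType) (r : T -> pred U) (S : {set T}) : {set U} :=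
  [set y | [exists x in S, r x y]].

Lemma outnbrsP (T U : finType) (r : T -> pred U) (S : {set T}) (y : U) :
  reflect (exists2 x, x \in S & r x y) (y \in outnbrs r S).
Proof. by rewrite inE; apply: exists_inP. Qed.

Lemma card_disjointU (T : finType) (A B : {set T}) :
  [disjoint A & B] -> #|A :|: B| = #|A| + #|B|.
Proof. by move=> dis; apply/eqP; rewrite (leq_card_setU A B).2. Qed.

Section Hall.

Variables (T U : finType) (r : T -> pred U).

Lemma outnbrsU (S S' : {set T}) :
  outnbrs r (S :|: S') = outnbrs r S :|: outnbrs r S'.
Proof.
apply/setP => y; apply/outnbrsP/setUP.
  by case=> x /setUP[xS|xS] rxy; [left|right]; apply/outnbrsP; exists x.
by case=> /outnbrsP[x xS rxy]; exists x => //; rewrite inE xS ?orbT.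
Qed.

(** Induction on [#|A|]: a tight subset splits the problem in two, and without one any first match
    can be extended. Restricting to [A] and [B] lets the induction shrink both sides; the [option]
    values spare a default element of [U], which may be empty. *)
Lemma hall_within (A : {set T}) (B : {set U}) :
    (forall S : {set T}, S \subset A -> #|S| <= #|outnbrs r S :&: B|) ->
  exists f : {ffun T -> option U},
    {in A &, injective f} /\
    (forall x, x \in A -> exists2 y, f x = Some y & (y \in B) && r x y).
Proof.
have [n] := ubnP #|A|; elim: n A B => // n IH A B ltAn hall.
have [-> | [x0 x0A]] := set_0Vmem A.
  by exists [ffun => None]; split=> x; rewrite inE.
have glue (S : {set T}) (C : {set U}) (f g : {ffun T -> option U}) :
    S \subset A -> C \subset B ->
    {in S &, injective f} ->
    (forall x, x \in S -> exists2 y, f x = Some y & (y \in C) && r x y) ->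
    {in A :\: S &, injective g} ->
    (forall x, x \in A :\: S ->
       exists2 y, g x = Some y & (y \in B :\: C) && r x y) ->
  exists h : {ffun T -> option U},
    {in A &, injective h} /\
    (forall x, x \in A -> exists2 y, h x = Some y & (y \in B) && r x y).
  move=> sSA sCB injf fP injg gP.
  exists [ffun x => if x \in S then f x else g x]; split=> [x y xA yA|x xA].
    rewrite !ffunE; case: ifP => xS; case: ifP => yS.
    - exact: injf.
    - have [u -> /andP[uC _]] := fP x xS.
      have [|v -> /andP[vC _] [uv]] := gP y; first by rewrite inE yS.
      by move: vC; rewrite -uv inE uC.
    - have [u -> /andP[uC _]] := fP y yS.
      have [|v -> /andP[vC _] [uv]] := gP x; first by rewrite inE xS.
      by move: vC; rewrite uv inE uC.
    - by apply: injg; rewrite inE ?xS ?yS.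
  rewrite ffunE; case: ifP => xS.
    have [y fy /andP[yC rxy]] := fP x xS.
    by exists y; rewrite // rxy (subsetP sCB).
  have [|y gy /andP[/setDP[yB _] rxy]] := gP x; first by rewrite inE xS.
  by exists y; rewrite ?yB.
(* A tight set is nonempty, proper in [A], and has exactly as many neighbours in [B] as elements. *)
have [/existsP[S /and3P[pSA Sn0 /eqP tight]] | loose] :=
    boolP [exists S : {set T},
      [&& S \proper A, S != set0 & #|outnbrs r S :&: B| == #|S|]].
  have sSA := proper_sub pSA.
  have [||f [injf fP]] := IH S (outnbrs r S :&: B).
  - by have := proper_card pSA; lia.
  - move=> S' sS'; rewrite setIA.
    have -> : outnbrs r S' :&: outnbrs r S = outnbrs r S'.
      by apply/setIidPl; rewrite -(setUidPr sS') outnbrsU subsetUl.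
    by apply: hall; apply: subset_trans sSA.
  have [||g [injg gP]] := IH (A :\: S) (B :\: (outnbrs r S :&: B)).
  - have := cardsID S A; rewrite (setIidPr sSA).
    by move: Sn0; rewrite -card_gt0; lia.
  - move=> S'; rewrite subsetD => /andP[sS'A dis].
    (* Hall's condition for [S' :|: S], minus the equality [tight], is Hall's condition for [S'] in
       what is left of [B]. *)
    have sU : S' :|: S \subset A by rewrite subUset sSA sS'A.
    have := hall _ sU; rewrite outnbrsU.
    rewrite (card_disjointU dis).
    rewrite -(cardsID (outnbrs r S :&: B) (_ :&: B)).
    have -> : (outnbrs r S' :|: outnbrs r S) :&: B :&: (outnbrs r S :&: B)
              = outnbrs r S :&: B.
      by apply/setP => y; rewrite !inE; do !case: (_ \in _); do ?case: existsP.
    have -> : ((outnbrs r S' :|: outnbrs r S) :&: B) :\: (outnbrs r S :&: B)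
              = outnbrs r S' :&: (B :\: (outnbrs r S :&: B)).
      apply/setP => y; rewrite !inE.
      by case: (y \in B); do ?case: existsP.
    by rewrite tight; lia.
  exact: (glue S (outnbrs r S :&: B) f g sSA (subsetIr _ _)).
(* Without tight sets the inequality is strict on nonempty proper subsets, so [x0] may be matched to
   any neighbour [y0]: losing [y0] costs at most one. *)
have /card_gt0P[y0] : 0 < #|outnbrs r [set x0] :&: B|.
  by have := hall [set x0]; rewrite sub1set cards1 => /(_ x0A).
case/setIP=> /outnbrsP[_ /set1P-> rxy0] y0B.
have [||g [injg gP]] := IH (A :\ x0) (B :\ y0).
- by have := cardsD1 x0 A; rewrite x0A; lia.
- move=> S sS.
  have [->|Sn0] := eqVneq S set0; first by rewrite cards0.
  have pSA : S \proper A by apply: sub_proper_trans sS (properD1 x0A).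
  move: loose => /existsPn/(_ S); rewrite pSA Sn0 /= => ne.
  have := hall S (proper_sub pSA); move: ne.
  by rewrite setIDA (cardsD1 y0 (_ :&: B)); case: (y0 \in _); lia.
apply: (glue [set x0] [set y0] [ffun => Some y0] g) => //.
- by rewrite sub1set.
- by rewrite sub1set.
- by move=> x y /set1P-> /set1P->.
- by move=> _ /set1P->; exists y0; rewrite ?ffunE // !inE eqxx.
Qed.

Theorem hall :
  (forall S : {set T}, #|S| <= #|outnbrs r S|) ->
  exists2 f : T -> U, injective f & forall x, r x (f x).
Proof.
move=> hallT; have [S _|f [injf fP]] := @hall_within setT setT.
  by rewrite setIT.
have P x : {y | f x == Some y & r x y}.
  by apply: sig2W; have [y -> /andP[_]] := fP x (in_setT x); exists y.
exists (fun x => s2val (P x)) => [x y exy|x]; last by case: (P x).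
apply: injf; rewrite ?inE //.
by rewrite (eqP (s2valP (P x))) (eqP (s2valP (P y))) exy.
Qed.

(** Choosing one out-neighbour for each vertex of [A] is injective, since no two vertices of [A]
    share one. *)
Lemma card_outnbrs_private (A : {set T}) :
    (forall x, x \in A -> exists y, r x y) ->
    (forall x x' y, x \in A -> x' \in A -> r x y -> r x' y -> x = x') ->
  #|A| <= #|outnbrs r A|.
Proof.
move=> ex priv.
have [->|[x0 x0A]] := set_0Vmem A; first by rewrite cards0.
have [y0 _] := ex x0 x0A.
pose f x := odflt y0 [pick y | r x y].
have fP x : x \in A -> r x (f x).
  move=> xA; rewrite /f; case: pickP => //= none.
  by have [y] := ex x xA; rewrite none.
rewrite -(card_in_imset (f := f) (D := A)); last first.
  by move=> x y xA yA fxy; apply: (priv x y (f x)); rewrite // ?fP // fxy fP.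
apply/subset_leq_card/subsetP => _ /imsetP[x xA ->].
by apply/outnbrsP; exists x; rewrite ?fP.
Qed.

End Hall.

(** * From an injective successor map to a cycle factor *)

Lemma cycle_factor_of_injective (T : finType) (e : rel T) (f : T -> T) :
  irreflexive e -> injective f -> (forall x, e x (f x)) ->
  exists F : seq (seq T), cycle_factor e F.
Proof.
move=> irr injf ef.
(* One orbit per root of [f]; irreflexivity of [e] rules out orbits of length 1. *)
exists [seq orbit f x | x <- enum (froots f)]; split.
- move=> _ /mapP[x _ ->].
  have cyc : cycle e (orbit f x).
    by apply: sub_cycle (cycle_orbit injf x) => u v /eqP <-; apply: ef.
  split; [| exact: orbit_uniq | exact: cyc].
  move: cyc (in_orbit f x).
  by case: (orbit f x) => [|u [|v s]] //=; rewrite irr.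
- rewrite pairwise_map.
  apply: (@sub_in_pairwise _ (mem (froots f)) [rel x y | x != y]).
  + move=> x y /eqP rx /eqP ry /= nxy; apply/pred0P => z /=.
    apply/andP => -[]; rewrite -!fconnect_orbit => cx cy.
    case/eqP: nxy; rewrite -rx -ry.
    have sym := fconnect_sym injf.
    by apply/(rootP sym); apply: connect_trans cx _; rewrite sym.
  + by apply/allP => x; rewrite mem_enum.
  + by rewrite -uniq_pairwise enum_uniq.
- move=> x; have sym := fconnect_sym injf.
  exists (orbit f (froot f x)).
    by apply/mapP; exists (froot f x); rewrite // mem_enum; apply: roots_root.
  by rewrite -fconnect_orbit sym; apply: connect_root.
Qed.

(** * Hall's condition inside one partite set *)

Section ConditionB.

Variables (a k : nat) (T : finType) (e : rel T).
Hypotheses (hk2 : 2 <= k) (hka : 2 * k <= a).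
Hypotheses (hstrong : strongly_connected e) (hB : condB e a k).

Lemma out_arc (x : T) : 1 < #|T| -> exists y, e x y.
Proof.
move=> T1; have /card_gt0P[z] : 0 < #|[set~ x]| by rewrite cardsC1; lia.
rewrite !inE => zx; have /connectP[[|y p] /= ] := hstrong x z.
  by move=> _ zE; rewrite zE eqxx in zx.
by case/andP=> exy _ _; exists y.
Qed.

(** As [2 * k <= a] gives [a + k <= 2 * a - k], both alternatives of [condB] force degree at least
    [a + k] on each vertex of a dominating pair. *)
Lemma small_deg_private (x y z : T) : deg e x < a + k -> e x z -> e y z -> x = y.
Proof.
move=> dx exz eyz; apply/eqP; apply: contraTT dx => /eqP nxy.
have : dominating_pair e x y by split=> //; exists z.
by case/hB; lia.
Qed.

Lemma card_outnbrs_side (X Y S : {set T}) :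
  bipartite e X Y -> #|X| = a -> #|Y| = a -> S \subset X ->
  #|S| <= #|outnbrs e S|.
Proof.
case=> XYT XY0 arcs hX hY.
have T1 : 1 < #|T|.
  by apply: leq_trans (max_card (mem X)); rewrite hX; lia.
have notXY x : x \in X -> x \in Y -> False.
  by move=> xX xY; have := in_set0 x; rewrite -XY0 inE xX xY.
have arcX x y : x \in X -> e x y -> y \in Y.
  by move=> xX /arcs[[]//|[xY _]]; case: (notXY x).
have arcY x y : x \in Y -> e x y -> y \in X.
  by move=> xY /arcs[[xX]|[]//]; case: (notXY x).
have arcYV x y : y \in Y -> e x y -> x \in X.
  by move=> yY /arcs[[]//|[_ yX]]; case: (notXY y).
have arcXV x y : y \in X -> e x y -> x \in Y.
  by move=> yX /arcs[[_ yY]|[]//]; case: (notXY y).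
(* Strong induction on [#|S|] stands in for a violating set of minimal size. *)
have [n] := ubnP #|S|; elim: n S => // n IH S ltSn sSX.
rewrite leqNgt; apply/negP => viol.
have sNY : outnbrs e S \subset Y.
  by apply/subsetP => y /outnbrsP[x xS]; apply: arcX; apply: (subsetP sSX).
have NYcap : Y :&: outnbrs e S = outnbrs e S by apply/setIidPr.
have SXcap : X :&: S = S by apply/setIidPr.
have [x [y [z [xS yS nxy exz eyz]]]] :
    exists x y z, [/\ x \in S, y \in S, x != y, e x z & e y z].
  have [/existsP[x /existsP[y /existsP[z /and5P[]]]]|none] :=
      boolP [exists x, exists y, exists z,
        [&& x \in S, y \in S, x != y, e x z & e y z]].
    by exists x, y, z.
  move: viol; rewrite ltnNge card_outnbrs_private // => [x _|x x' y xS x'S exy ex'y].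
    exact: out_arc.
  apply/eqP; apply: contraNT none => nxx'.
  by apply/existsP; exists x; apply/existsP; exists x'; apply/existsP;
     exists y; apply/and5P.
have degS u : u \in S -> deg e u <= #|outnbrs e S| + a.
  move=> uS; apply: leq_add.
    apply/subset_leq_card/subsetP => v; rewrite inE => euv.
    by apply/outnbrsP; exists u.
  rewrite -hY; apply/subset_leq_card/subsetP => v; rewrite inE.
  exact/arcXV/(subsetP sSX).
(* One of [x], [y] has degree at least [2 * a - k], while [degS] bounds it by
   [#|outnbrs e S| + a]. *)
have Nlarge : a <= #|outnbrs e S| + k.
  have dom : dominating_pair e x y by split; [apply/eqP | exists z].
  by have := degS x xS; have := degS y yS; case: (hB dom); lia.
pose R := Y :\: outnbrs e S.
have cardR : #|outnbrs e S| + #|R| = a.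
  by rewrite -hY -(cardsID (outnbrs e S) Y) NYcap.
have cardXS : #|S| + #|X :\: S| = a.
  by rewrite -hX -(cardsID S X) SXcap.
(* In-neighbours of [u] avoid [S], and [#|X :\: S| = a - #|S| < a - #|outnbrs e S| <= k]. *)
have degR u : u \in R -> deg e u < a + k.
  case/setDP=> uY uN.
  have dout : outdeg e u <= a.
    by rewrite -hX; apply/subset_leq_card/subsetP => v; rewrite inE; apply: arcY.
  have din : indeg e u <= #|X :\: S|.
    apply/subset_leq_card/subsetP => v; rewrite !inE => evu.
    rewrite (arcYV _ _ uY evu) andbT; apply: contra uN => vS.
    by apply/outnbrsP; exists v.
  by rewrite /deg; lia.
pose W := outnbrs e R.
have cardW : #|R| <= #|W|.
  apply: card_outnbrs_private => [u _|u v w uR _]; first exact: out_arc.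
  exact: small_deg_private (degR u uR).
have sWX : W \subset X.
  by apply/subsetP => w /outnbrsP[u /setDP[uY _]]; apply: arcY.
have degW w : w \in W -> deg e w < a + k.
  move=> wW; have wX := subsetP sWX _ wW.
  have dout : outdeg e w <= a.
    by rewrite -hY; apply/subset_leq_card/subsetP => v; rewrite inE; apply: arcX.
  have din : indeg e w <= 1.
    have /outnbrsP[u uR euw] := wW.
    rewrite -(cards1 u); apply/subset_leq_card/subsetP => v.
    rewrite !inE => evw; apply/eqP/esym.
    exact: small_deg_private (degR u uR) euw evw.
  by rewrite /deg; lia.
(* [W] is too large to fit in [X :\: S]: [#|W| >= #|R| = a - #|outnbrs e S| > a - #|S|]. *)
have meet : 0 < #|S :&: W|.
  have : #|W :\: S| <= #|X :\: S| by apply/subset_leq_card/setSD.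
  by have := cardsID S W; rewrite setIC; lia.
have cardSW : #|S :&: W| <= #|outnbrs e (S :&: W)|.
  apply: card_outnbrs_private => [u _|u v w /setIP[_ uW] _]; first exact: out_arc.
  exact: small_deg_private (degW u uW).
have splitS := cardsID W S.
(* The union is disjoint because a vertex of [W] shares its out-neighbours with no other vertex. *)
have splitN : #|outnbrs e S| = #|outnbrs e (S :&: W)| + #|outnbrs e (S :\: W)|.
  rewrite -{1}(setID S W) outnbrsU.
  apply: card_disjointU; apply/pred0P => v /=; apply/andP => -[].
  move=> /outnbrsP[u /setIP[_ uW] euv] /outnbrsP[w /setDP[_ wW] ewv].
  by case/negP: wW; rewrite -(small_deg_private (degW u uW) euv ewv).
(* By [meet] this set is smaller than [S]; by [cardSW] and [splitN] it still violates the bound. *)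
have := IH (S :\: W); rewrite (subset_trans (subsetDl _ _) sSX).
by move=> /(_ ltac:(lia) isT); lia.
Qed.

End ConditionB.

Theorem theorem1p10 (a k : nat) (T : finType) (e : rel T) (X Y : {set T})
    (ha : 4 <= a) (hk2 : 2 <= k) (hka : 2 * k <= a)
    (hloop : irreflexive e)
    (hbip : bipartite e X Y) (hX : #|X| = a) (hY : #|Y| = a)
    (hstrong : strongly_connected e)
    (hB : condB e a k) :
  exists F : seq (seq T), cycle_factor e F.
Proof.
have hbipC : bipartite e Y X.
  case: hbip => XYT XY0 arcs; split; rewrite 1?setUC 1?setIC //.
  by move=> x y /arcs[]; [right|left].
suff /hall[f injf ef] : forall S : {set T}, #|S| <= #|outnbrs e S|.
  exact: cycle_factor_of_injective ef.
case: (hbip) => XYT XY0 arcs S.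
have notXY x : x \in X -> x \in Y -> False.
  by move=> xX xY; have := in_set0 x; rewrite -XY0 inE xX xY.
have sideX := card_outnbrs_side hk2 hka hstrong hB hbip hX hY (subsetIr S X).
have sideY := card_outnbrs_side hk2 hka hstrong hB hbipC hY hX (subsetIr S Y).
(* The two halves of [S] have out-neighbours on opposite sides, so the two one-sided bounds add
   up. *)
have SE : S = (S :&: X) :|: (S :&: Y) by rewrite -setIUr XYT setIT.
have -> : outnbrs e S = outnbrs e (S :&: X) :|: outnbrs e (S :&: Y).
  by rewrite -outnbrsU -SE.
rewrite card_disjointU.
  rewrite {1}SE.
  by apply: leq_trans (leq_card_setU _ _).1 _; apply: leq_add.
apply/pred0P => v /=; apply/andP => -[].
move=> /outnbrsP[x /setIP[_ xX] /arcs exv] /outnbrsP[y /setIP[_ yY] /arcs eyv].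
by case: exv eyv => -[? ?] [] [? ?];
  first [exact: (notXY x) | exact: (notXY y) | exact: (notXY v)].
Qed.
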